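(* Let $k$ be an algebraically closed field, $n\ge 5$, let $Q_1,\dots,Q_n\in\mathbb{P}^{n-3}_k$ be general points with Gale dual $p\in \mathrm{Gr}(2,n)$, let $X_n=X_n(Q)$ be the blow-up of $\mathbb{P}^{n-3}$ at $Q_1,\dots,Q_n$, and fix $y\in\mathcal{G}(p)$. Then the spectrum of $\mathrm{Cox}(X_n)$ can be embedded, by means of the epimorphism $k[\bigwedge^{even}W]\to \mathrm{Cox}(X_n)$, $f_B\mapsto T^{1-\frac12|B|}F_B(x,y,p)$, into the spinor variety $S^+\subset\bigwedge^{even}W$, where $W\simeq k^n$. Moreover, if $I_X\subset k[\bigwedge^{even}W]$ denotes the homogeneous prime ideal presenting the Cox ring of $X_n$, i.e. the kernel of this epimorphism, then $$I_X\ \supseteq\ \sum_{c\in\mathcal{G}(p)} a(c)\star I_{\mathrm{spin}}.$$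
   Context: **Cox ring.** $X_n(Q)$ has Picard group $\cong\mathbb{Z}^{n+1}$ with basis $H$ (pullback of the hyperplane class) and $E_1,\dots,E_n$ (exceptional classes). $\mathrm{Cox}(X_n(Q))=\bigoplus_{m\in\mathbb{Z}^{n+1}}H^0(X_n(Q),\mathcal{O}(m_0h+m_1e_1+\cdots+m_ne_n))$, where $h,e_1,\dots,e_n$ are fixed divisors in the classes $H,E_1,\dots,E_n$. **Gale dual.** Represent $Q_1,\dots,Q_n$ (assumed in linearly general position) as the columns of an $(n-2)\times n$ matrix. A Gale dual $p$ is a point of the Grassmannian $\mathrm{Gr}(2,n)$ given by a $2\times n$ matrix whose rows span the kernel of that matrix; it is determined up to the action of the $n$-dimensional diagonal torus. **Determinants and pfaffians.** Represent a point of $\mathrm{Gr}(2,n)$ by a $2\times n$ matrix with columns $(X_i,x_i)^T$, and write $x_{ij}=X_ix_j-X_jx_i$; similarly for $(Y_i,y_i)$ with $y_{ij}$ and $(P_i,p_i)$ with $p_{ij}$. An even subset of $[n]=\{1,\dots,n\}$ is a subset of even cardinality. For an even subset $B=\{b_1<\dots<b_{2s}\}$, $\Psi_B(x,p)$ is the determinant of the $2s\times 2s$ matrix whose $m$-th row is $$(x_{b_m}p_{b_m}^{s-1},\,x_{b_m}p_{b_m}^{s-2}P_{b_m},\dots,x_{b_m}P_{b_m}^{s-1},\,X_{b_m}p_{b_m}^{s-1},\,X_{b_m}p_{b_m}^{s-2}P_{b_m},\dots,X_{b_m}P_{b_m}^{s-1}),$$ with $\Psi_\emptyset=1$. $F_B(x,y,p)$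 is the pfaffian of the submatrix, with rows and columns indexed by $B$, of the skew-symmetric $n\times n$ matrix (zero diagonal) with off-diagonal entries $x_{ij}y_{ij}/p_{ij}$. Here $x_i,X_i$ are indeterminates while $y,p$ are fixed; $F_B$ lies in $k[x_{ij}]$, the subalgebra of $k[x_1,\dots,x_n,X_1,\dots,X_n]$ generated by all $x_{ij}$. **The set $\mathcal{G}(p)$ and the vectors $a(c)$.** $\mathcal{G}(p)=\{c\in\mathrm{Gr}(2,n):\Psi_B(c,p)\ne0\text{ for all even }B\subset[n]\}$. For $c\in\mathcal{G}(p)$, $a(c)$ is the vector with entries $a(c)_B=\Psi_B(c,p)\,\Psi_B(y,p)^{-1}$, $B\subset[n]$ even. (The condition and the ideals below do not depend on the chosen matrix representatives.) **Polynomial ring and presentation.** $k[\bigwedge^{even}W]$ is the polynomial ring in the $2^{n-1}$ variables $f_B$, $B\subset[n]$ even; these are coordinates on $\bigwedge^{even}W$. The subalgebra of $k[x_{ij}][T^{\pm}]$ ($T$ a further variable) generated by all $T^{1-\frac12|B|}F_B(x,y,p)$ is isomorphic to $\mathrm{Cox}(X_n(Q))$ and is identified with it; this gives the epimorphism in the claim. **Spinor ideal.** $I_{\mathrm{spin}}\subset k[\bigwedge^{even}W]$ is the ideal generated by all homogeneous polynomials in the kernel of the $k$-algebra homomorphism $k[\bigwedge^{even}W]\to k[z_{ij}:1\le i<j\le n]$ sending $f_B$ to the pfaffian of the submatrix with rows and columns indexed by $B$ of the generic skew-symmetric matrix $(z_{ij})$. $S^+$ is the affine variety in $\bigwedge^{even}W$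 defined by $I_{\mathrm{spin}}$. **Torus action.** $a\star I$ denotes the ideal obtained from $I$ by scaling each variable $f_B$ by $a_B$: $a\star I=\{g((a_Bf_B)_B): g\in I\}$. *)

(* Defs.v *)
From HB Require Import structures.
From mathcomp Require Import all_boot all_order all_algebra.
From mathcomp Require Import mpoly.

Set Implicit Arguments.
Unset Strict Implicit.
Unset Printing Implicit Defensive.

Import Order.TTheory GRing.Theory.
Local Open Scope ring_scope.

Local Notation "x %:F" := (@FracField.tofrac _ x) : ring_scope.

(* A k-algebra is given as a subset A of a ring R, together with the
   structure map k -> R; an ideal is a subset of the ring. *)

Section Algebra.

Variable k : closedFieldType.

Inductive subalg_gen (R : comNzRingType) (iR : k -> R) (G : R -> Prop) :
    R -> Prop :=
| SubalgScalar c : subalg_gen iR G (iR c)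
| SubalgGen a of G a : subalg_gen iR G a
| SubalgAdd a b of subalg_gen iR G a & subalg_gen iR G b :
    subalg_gen iR G (a + b)
| SubalgMul a b of subalg_gen iR G a & subalg_gen iR G b :
    subalg_gen iR G (a * b).

Definition alg_hom (R S : comNzRingType) (iR : k -> R) (iS : k -> S)
    (A : R -> Prop) (B : S -> Prop) (f : R -> S) : Prop :=
  [/\ forall a, A a -> B (f a),
      forall c, f (iR c) = iS c,
      forall a b, A a -> A b -> f (a + b) = f a + f b
    & forall a b, A a -> A b -> f (a * b) = f a * f b].

Definition alg_iso (R S : comNzRingType) (iR : k -> R) (iS : k -> S)
    (A : R -> Prop) (B : S -> Prop) (f : R -> S) : Prop :=
  [/\ alg_hom iR iS A B f,
      forall a b, A a -> A b -> f a = f b -> a = b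
    & forall b, B b -> exists2 a, A a & f a = b].

Definition alg_epi (R S : comNzRingType) (iR : k -> R) (iS : k -> S)
    (A : R -> Prop) (B : S -> Prop) (f : R -> S) : Prop :=
  alg_hom iR iS A B f /\ (forall b, B b -> exists2 a, A a & f a = b).

Definition full (R : comNzRingType) : R -> Prop := fun=> True.

(* k-points of the spectrum of A; only the values of chi on A matter. *)
Definition kpoint (R : comNzRingType) (iR : k -> R) (A : R -> Prop)
    (chi : R -> k) : Prop :=
  alg_hom iR id A (full (R:=k)) chi.

Definition ideal_gen (R : comNzRingType) (G : R -> Prop) : R -> Prop :=
  fun f => exists2 s : seq (R * R),
    (forall u, u \in s -> G u.2) & f = \sum_(u <- s) u.1 * u.2.

Definition ideal_sum (R : comNzRingType) (I : Type) (P : I -> Prop)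
    (J : I -> R -> Prop) : R -> Prop :=
  fun f => exists2 s : seq R,
    (forall g, g \in s -> exists2 i, P i & J i g) & f = \sum_(g <- s) g.

Definition prime_ideal (R : comNzRingType) (I : R -> Prop) : Prop :=
  [/\ I 0 /\ (forall f g, I f -> I g -> I (f + g)),
      forall f g, I g -> I (f * g),
      ~ I 1
    & forall f g, I (f * g) -> I f \/ I g].

Definition homogeneous_ideal (N : nat) (I : {mpoly k[N]} -> Prop) : Prop :=
  forall g d, I g -> I (pihomog mdeg d g).

Definition kernel (R S : comNzRingType) (f : R -> S) : R -> Prop :=
  fun g => f g = 0.

Definition zero_locus (N : nat) (I : {mpoly k[N]} -> Prop)
    (v : 'I_N -> k) : Prop :=
  forall g, I g -> g.@[v] = 0.

Definition scale_ideal (N : nat) (a : 'I_N -> k) (I : {mpoly k[N]} -> Prop) :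
    {mpoly k[N]} -> Prop :=
  fun f => exists2 g, I g & f = g \mPo [tuple a i *: 'X_i | i < N].

(* phi induces a closed embedding of Spec A, as a scheme and on k-points,
   into the closed subscheme of affine N-space defined by I. *)
Record spec_closed_embedding (N : nat) (S : comNzRingType) (iS : k -> S)
    (A : S -> Prop) (phi : {mpoly k[N]} -> S) (I : {mpoly k[N]} -> Prop) :
    Prop := SpecClosedEmbedding {
  sce_epi : alg_epi (fun c => c%:MP) iS (full (R:={mpoly k[N]})) A phi;
  sce_factor : forall g, I g -> phi g = 0;
  sce_point : forall chi, kpoint iS A chi ->
    zero_locus I (fun i => chi (phi 'X_i));
  sce_inj : forall chi1 chi2, kpoint iS A chi1 -> kpoint iS A chi2 ->
    (forall i, chi1 (phi 'X_i) = chi2 (phi 'X_i)) ->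
    forall a, A a -> chi1 a = chi2 a;
  sce_closed : forall v, zero_locus (kernel phi) v <->
    exists2 chi, kpoint iS A chi & forall i, chi (phi 'X_i) = v i
}.

End Algebra.

(* Laplace expansion along the first row; no division, so that it is valid in
   characteristic 2. *)
Fixpoint pfaffian (R : comNzRingType) (m : nat) : 'M[R]_m -> R :=
  match m return 'M[R]_m -> R with
  | 0 => fun=> 1
  | 1 => fun=> 0
  | m'.+2 => fun M =>
      \sum_(j < m'.+1) (-1) ^+ j * M ord0 (lift ord0 j) *
        pfaffian (mxsub (fun i : 'I_m' => lift ord0 (lift j i))
                        (fun i : 'I_m' => lift ord0 (lift j i)) M)
  end.

(* [enum_val] lists B in increasing order. *)
Definition pfaffian_sub (R : comNzRingType) (n : nat) (M : 'M[R]_n)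
    (B : {set 'I_n}) : R :=
  pfaffian (mxsub (fun i : 'I_#|B| => enum_val i)
                  (fun i : 'I_#|B| => enum_val i) M).

Definition evens (n : nat) : {set {set 'I_n}} :=
  [set B : {set 'I_n} | ~~ odd #|B|].

(* The number of variables f_B; the variable with index i is f_(even_of i). *)
Definition nevens (n : nat) : nat := #|evens n|.

Definition even_of (n : nat) (i : 'I_(nevens n)) : {set 'I_n} := enum_val i.

Section Spinor.

Variables (k : closedFieldType) (n : nat).

(* A point of Gr(2,n) is represented by a 2 x n matrix of rank 2, whose row 0
   is (X_i)_i and whose row 1 is (x_i)_i. *)
Definition gr2 (M : 'M[k]_(2, n)) : Prop := \rank M = 2.

Definition plucker (R : comNzRingType) (M : 'M[R]_(2, n)) (i j : 'I_n) : R :=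
  M 0 i * M 1 j - M 0 j * M 1 i.

Definition Psi (B : {set 'I_n}) (x p : 'M[k]_(2, n)) : k :=
  let s := #|B|./2 in
  \det (\matrix_(r < #|B|, j < #|B|)
    let b := enum_val r in
    (if (j < s)%N then x 1 b else x 0 b) *
      p 1 b ^+ (s.-1 - j %% s) * p 0 b ^+ (j %% s)).

Definition calG (p c : 'M[k]_(2, n)) : Prop :=
  gr2 c /\ forall B, B \in evens n -> Psi B c p != 0.

Definition avec (y p c : 'M[k]_(2, n)) (i : 'I_(nevens n)) : k :=
  Psi (even_of i) c p / Psi (even_of i) y p.

(* The indeterminates X_i and x_i. *)
Definition xgen : 'M[{mpoly k[n + n]}]_(2, n) :=
  \matrix_(r < 2, i < n) 'X_(if r == 0 then lshift n i else rshift n i).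

Definition Fpf (B : {set 'I_n}) (y p : 'M[k]_(2, n)) : {mpoly k[n + n]} :=
  pfaffian_sub (\matrix_(i, j)
    ((plucker y i j / plucker p i j) *: plucker xgen i j)) B.

(* This field contains k[x_ij][T, T^-1]. *)
Definition fieldxT := {fraction {poly {mpoly k[n + n]}}}.

Definition constxT (c : k) : fieldxT := ((c%:MP)%:P)%:F.

Definition cox_gen (y p : 'M[k]_(2, n)) (i : 'I_(nevens n)) : fieldxT :=
  let B := even_of i in
  ('X%:F : fieldxT) ^ (1 - (#|B|./2)%:Z) * ((Fpf B y p)%:P)%:F.

Definition cox_subalg (y p : 'M[k]_(2, n)) : fieldxT -> Prop :=
  subalg_gen constxT (fun f => exists i, f = cox_gen y p i).

Definition cox_map (y p : 'M[k]_(2, n)) :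
    {mpoly k[nevens n]} -> fieldxT :=
  mmap constxT (cox_gen y p).

(* Only the variables z_ij with i < j occur; adjoining the other ones to the
   target of spin_map does not change its kernel. *)
Definition zgen : 'M[{mpoly k[n * n]}]_n :=
  \matrix_(i, j) if (i < j)%N then 'X_(mxvec_index i j)
                 else if (j < i)%N then - 'X_(mxvec_index j i) else 0.

Definition spin_map : {mpoly k[nevens n]} -> {mpoly k[n * n]} :=
  mmap (fun c => c%:MP) (fun i => pfaffian_sub zgen (even_of i)).

Definition spin_ideal : {mpoly k[nevens n]} -> Prop :=
  ideal_gen (fun g => kernel spin_map g /\ exists d, g \is d.-homog).

End Spinor.

Section BlowUp.

Variables (k : closedFieldType) (n : nat).

(* Column i of Q holds homogeneous coordinates of the point Q_i of P^(n-3). *)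
Definition linearly_general (Q : 'M[k]_(n - 2, n)) : Prop :=
  forall f : 'I_(n - 2) -> 'I_n, injective f -> colsub f Q \in unitmx.

Definition gale_dual (Q : 'M[k]_(n - 2, n)) (p : 'M[k]_(2, n)) : Prop :=
  gr2 p /\ (p :=: kermx Q^T)%MS.

(* F has multiplicity at least m at q: its Taylor expansion at q has no term
   of degree less than m. *)
Definition mult_ge (r : nat) (q : 'I_r -> k) (F : {mpoly k[r]}) (m : int) :
    Prop :=
  forall u, u \in msupp (F \mPo [tuple 'X_j + (q j)%:MP | j < r]) ->
    (m <= (mdeg u)%:Z)%R.

(* F is homogeneous of degree d (d < 0 only for F = 0) and has multiplicity at
   least - m_i at every Q_i.  Sending F to F / l^d, where l is the linear form
   of a hyperplane that misses all Q_i and whose pullback is h, identifies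
   these F with the rational functions f on X_n(Q) such that
   div f + d h + m_1 e_1 + ... + m_n e_n >= 0: the order along e_i is the
   multiplicity at Q_i. *)
Definition sections (Q : 'M[k]_(n - 2, n)) (d : int) (m : 'I_n -> int)
    (F : {mpoly k[n - 2]}) : Prop :=
  (F = 0 \/ exists2 e : nat, d = e%:Z & F \is e.-homog) /\
  forall i, mult_ge (fun j => Q j i) F (- m i).

(* This field contains k[z_1, ..., z_(n-2)][t_1, t_1^-1, ..., t_n, t_n^-1]. *)
Definition fieldzt := {fraction {mpoly {mpoly k[n - 2]}[n]}}.

Definition constzt (c : k) : fieldzt := ((c%:MP)%:MP)%:F.

(* The section F of the multidegree (d, m) is written F t^m; the power of a
   variable recording d is redundant, d being the degree of F. *)
Definition cox_homog (Q : 'M[k]_(n - 2, n)) (f : fieldzt) : Prop :=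
  exists d m F, sections Q d m F /\
    f = (F%:MP)%:F * \prod_(i < n) (('X_i)%:F : fieldzt) ^ (m i).

Definition cox_ring (Q : 'M[k]_(n - 2, n)) (f : fieldzt) : Prop :=
  exists2 s : seq fieldzt,
    (forall g, g \in s -> cox_homog Q g) & f = \sum_(g <- s) g.

End BlowUp.

(* Main.v *)
Require Import Defs.
From HB Require Import structures.
From Stdlib Require Import ClassicalEpsilon.
From mathcomp Require Import all_boot all_order all_algebra.
From mathcomp Require Import perm mpoly.
From mathcomp Require Import ring zify.

(** Why the theorem holds.  Write M(c) for the skew-symmetric matrix with
    entries x_ij c_ij / p_ij, so that F_B(x,c,p) = Pf M(c)_B.  As a pfaffian of
    size |B| has degree |B|/2, the generators of the Cox ring are
      T^(1 - |B|/2) F_B(x,c,p) = T Pf ((T^-1 M(c))_B).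
    The factor T is harmless on homogeneous relations, so every spinor relation
    vanishes on these generators, whatever c is
    ([spin_ideal_pfaffian], [spin_ideal_cox_map]); for c = y this is the
    embedding into the spinor variety.

    For the translates a(c) * I_spin it must be seen that scaling by a(c) turns
    the generators attached to y into those attached to c:
      Psi_B(c,p) F_B(x,y,p) = Psi_B(y,p) F_B(x,c,p)          [Fpf_ratio].
    This is a consequence of Okada's evaluation of the pfaffian F_B, which for
    p_i = (t_i, 1) reads
      Pf (x_ij y_ij / (t_i - t_j)) prod_(i < j) (t_i - t_j) = Psi(x,t) Psi(y,t)
    [pfaffian_vander2].  Its proof is by induction on the size m + 2 of the
    pfaffian.  Expanding along the first row makes the left-hand side a
    polynomial in t_0 of degree at most m, and so is the right-hand side.  Both
    are determined by their values at the m + 1 points t_j, j > 0.  At t_0 = t_j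
    a single term of the expansion survives, and the two determinants split off
    a 2 x 2 block ([vander2_collision]); what remains is the case of size m.
    The general p is reduced to p_i = (t_i, 1) by rescaling the columns, after a
    generic shear p_i -> p_i + u P_i which changes no p_ij and makes all the
    p_i invertible ([pfaffian_ratio]).  The p_ij are nonzero because p is the
    Gale dual of points in linearly general position
    ([gale_dual_plucker_neq0]).

    The kernel I_X is prime because the Cox ring lies in a field.  It is
    homogeneous because all generators have degree 2 once each X_i and x_i
    has degree 1 and T has degree 2 ([cox_kernel_homogeneous]).  Finally a
    closed embedding of spectra amounts to a surjection of algebras
    ([epi_closed_embedding]), and surjections can be composed with
    isomorphisms. *)

Set Implicit Arguments.
Unset Strict Implicit.
Unset Printing Implicit Defensive.
Import Order.TTheory GRing.Theory.
Local Open Scope ring_scope.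

(** * Determinants of Vandermonde type *)

(** The matrix of Psi for the points p_i = (t_i, 1). *)
Definition vander2_mx (R : comNzRingType) m (x : 'M[R]_(2, m)) (t : 'I_m -> R) :
    'M[R]_m :=
  \matrix_(r < m, j < m)
    ((if (j < m./2)%N then x 1 r else x 0 r) * t r ^+ (j %% m./2)).

Definition vander2 (R : comNzRingType) m (x : 'M[R]_(2, m)) (t : 'I_m -> R) : R :=
  \det (vander2_mx x t).

(** Reindexing rows and columns changes a determinant by a sign that depends
    on the reindexing only, so that it cancels in a product of two
    determinants; this spares the computation of signs below. *)
Lemma mul_det_mxsub (R : comNzRingType) a b (f g : 'I_a -> 'I_b) (A B : 'M[R]_b) :
    a = b -> injective f -> injective g ->
  \det (mxsub f g A) * \det (mxsub f g B) = \det A * \det B.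
Proof.
move=> eab; subst b => fI gI.
have sub C : mxsub f g C = perm_mx (perm fI) *m C *m (perm_mx (perm gI)^-1).
  rewrite -row_permE -col_permE; apply/matrixP=> i j.
  by rewrite !mxE !permE.
rewrite !sub !det_mulmx !det_perm.
set u := (-1) ^+ _; set v := (-1) ^+ _.
have u2 : u * u = 1 by rewrite /u -expr2 sqrr_sign.
have v2 : v * v = 1 by rewrite /v -expr2 sqrr_sign.
by transitivity ((u * u) * (v * v) * (\det A * \det B)); [ring | rewrite u2 v2 !mul1r].
Qed.

Lemma det_mx22 (R : comNzRingType) (A : 'M[R]_2) :
  \det A = A 0 0 * A 1 1 - A 0 1 * A 1 0.
Proof.
rewrite (expand_det_row _ 0) big_ord_recl big_ord1 /cofactor !det_mx11 !mxE /=.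
have -> : lift 0 (0 : 'I_1) = 1 :> 'I_2 by apply: val_inj.
have -> : lift 1 (0 : 'I_1) = 0 :> 'I_2 by apply: val_inj.
by rewrite addn0 expr0 expr1 mul1r mulN1r mulrN.
Qed.

Lemma split_lshift a b (i : 'I_a) : split (lshift b i) = inl i.
Proof. exact: (unsplitK (inl i)). Qed.

Lemma split_rshift a b (i : 'I_b) : split (rshift a i) = inr i.
Proof. exact: (unsplitK (inr i)). Qed.

Definition drop2 m (j : 'I_m.+1) (i : 'I_m) : 'I_m.+2 := lift ord0 (lift j i).

Section Collision.
Variables (R : comNzRingType) (s : nat).
Local Notation m := (s + s)%N.
Variables (t : 'I_m.+2 -> R) (j : 'I_m.+1).
Hypothesis tj : t ord0 = t (lift ord0 j).
Let q := t ord0.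

Let half0 : m./2 = s.
Proof. by rewrite addnn doubleK. Qed.

Let shear : 'M[R]_m.+2 :=
  \matrix_(i, l) ((i == l)%:R - q *+ ((l %% s.+1 != 0) && (i.+1 == l :> nat))%N).

Let det_shear : \det shear = 1.
Proof.
rewrite -det_tr det_trig.
  rewrite big1 // => i _; rewrite !mxE eqxx.
  by rewrite (gtn_eqF (ltnSn i)) andbF subr0.
apply/is_trig_mxP=> i l il; rewrite !mxE.
have -> : (l == i) = false by apply/negbTE; rewrite -val_eqE /= neq_ltn il orbT.
have -> : (l.+1 == i :> nat) = false by apply/negbTE; rewrite neq_ltn [(i < _)%N]ltnS (ltnW il) orbT.
by rewrite andbF subr0.
Qed.

Let reduced (x : 'M[R]_(2, m.+2)) : 'M[R]_m.+2 :=
  \matrix_(i, l) ((if (l < s.+1)%N then x 1 i else x 0 i) *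
    (if (l %% s.+1)%N is a.+1 then t i ^+ a * (t i - q) else 1)).

Let mul_shear x : vander2_mx x t *m shear = reduced x.
Proof.
apply/matrixP=> i l; rewrite !mxE.
under eq_bigr => h _ do rewrite !mxE mulrBr mulr_natr -mulrnAr mulrnAr.
rewrite sumrB (bigD1 l) //= eqxx mulr1n big1 ?addr0; last first.
  by move=> h /negbTE ->; rewrite mulr0n.
rewrite half0.
case E: (l %% s.+1)%N => [|a] /=.
  by rewrite big1 ?subr0 // => h _; rewrite mulr0n mulr0.
have l0 : (0 < l)%N by case: (l : nat) E => //; rewrite mod0n.
have lt : (l.-1 < m.+2)%N by have := ltn_ord l; lia.
have E' : (l.-1 %% s.+1)%N = a.
  have := divn_eq l s.+1; rewrite E => el.
  have -> : l.-1 = (l %/ s.+1 * s.+1 + a)%N by lia.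
  by rewrite modnMDl modn_small //; have := ltn_pmod l (ltn0Sn s); rewrite E; lia.
rewrite (bigD1 (Ordinal lt)) //= prednK // eqxx mulr1n big1 ?addr0; last first.
  move=> h /negbTE hl; case: eqP => // hl'.
    by move: hl; rewrite -val_eqE /= -hl' /= eqxx.
  by rewrite mulr0n mulr0.
rewrite E'.
have -> : (l <= s.+1)%N = (l < s.+1)%N.
  apply/idP/idP; last by lia.
  move=> h1; rewrite ltnNge; apply/negP=> h2.
  have ls : l = s.+1 :> nat by lia.
  by move: E; rewrite ls modnn.
by rewrite exprS; ring.
Qed.

(* The two rows and the two columns of the split block are moved to the end. *)
Let rows (i : 'I_(m + 2)) : 'I_m.+2 :=
  match split i with
  | inl l => drop2 j l
  | inr l => if l == 0 then ord0 else lift ord0 j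
  end.

Let cols (i : 'I_(m + 2)) : 'I_m.+2 :=
  match split i with
  | inl l => inord (if (l < s)%N then l.+1 else l.+2)
  | inr l => inord (if l == 0 then 0%N else s.+1)
  end.

Let rows_inj : injective rows.
Proof.
move=> a b; rewrite /rows /drop2 -{2}(splitK a) -{2}(splitK b).
case: (split a) => [l|l]; case: (split b) => [h|h] //=.
- by move/lift_inj/lift_inj ->.
- case: eqP => _; first by move/eqP; rewrite eq_sym (negbTE (neq_lift _ _)).
  by move/lift_inj/eqP; rewrite eq_sym (negbTE (neq_lift _ _)).
- case: eqP => _; first by move/eqP; rewrite (negbTE (neq_lift _ _)).
  by move/lift_inj/eqP; rewrite (negbTE (neq_lift _ _)).
- move=> e; congr (rshift _ _); apply/val_inj; move: e.
  by case: l h => [[|[]]] // p [[|[]]] //= p' /(congr1 val).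
Qed.

Let cols_val (i : 'I_(m + 2)) : cols i = 
  match split i with
  | inl l => (if (l < s)%N then l.+1 else l.+2)
  | inr l => (if l == 0 then 0%N else s.+1)
  end :> nat.
Proof.
rewrite /cols; case: split => l; rewrite inordK //.
  by have := ltn_ord l; case: ifP; lia.
by case: ifP => _; lia.
Qed.

Let cols_inj : injective cols.
Proof.
move=> a b /(congr1 val) /=; rewrite !cols_val -{2}(splitK a) -{2}(splitK b).
case: (split a) => [l|l]; case: (split b) => [h|h] //=.
- move=> e; congr lshift; apply/val_inj => /=; move: e.
  by case: ifP; case: ifP; lia.
- by case: ifP; case: ifP; lia.
- by case: ifP; case: ifP; lia.
- move=> e; congr (rshift _ _); apply/val_inj; move: e.
  by case: l h => [[|[]]] // p [[|[]]].
Qed.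

Let det_reduced x : \det (mxsub rows cols (reduced x)) =
  - plucker x ord0 (lift ord0 j) * 
   ((\prod_(l < m) (t (drop2 j l) - q)) *
     vander2 (colsub (drop2 j) x) (t \o drop2 j)).
Proof.
set B := mxsub _ _ _; rewrite -[B]submxK.
have -> : dlsubmx B = 0.
  apply/matrixP=> i l; rewrite !mxE cols_val /rows !split_lshift !split_rshift /=.
  case E: (_ %% _)%N => [|a].
    move: E; case: ltnP => ls; first by rewrite modn_small.
    have -> : l.+2 = (s.+1 + (l - s).+1)%N by lia.
    by rewrite modnDl modn_small //; have := ltn_ord l; lia.
  by case: (i == 0); rewrite /q -?tj subrr !mulr0.
rewrite det_ublock mulrC; congr (_ * _).
  rewrite det_mx22 !mxE !cols_val /rows !split_rshift /= modnn ltnn !mulr1.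
  rewrite /plucker; ring.
rewrite /vander2.
have -> : ulsubmx B = diag_mx (\row_l (t (drop2 j l) - q)) *m
    vander2_mx (colsub (drop2 j) x) (t \o drop2 j).
  rewrite mul_diag_mx; apply/matrixP=> i l.
  rewrite !mxE cols_val /rows !split_lshift half0 /=.
  case: (ltnP l s) => ls.
    rewrite modn_small //= ltnS ls modn_small //; ring.
  have -> : l.+2 = (s.+1 + (l - s).+1)%N by lia.
  rewrite modnDl modn_small; last by have := ltn_ord l; lia.
  have -> : (s.+1 + (l - s).+1 < s.+1)%N = false by lia.
  have -> : (l %% s)%N = (l - s)%N.
    by rewrite -[in LHS](subnKC ls) modnDl modn_small //; have := ltn_ord l; lia.
  ring.
rewrite det_mulmx det_diag; congr (_ * _).
by apply: eq_bigr => l _; rewrite mxE.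
Qed.

(** When t_0 and t_(j+1) coincide, both being q, replace each column of
    exponent a > 0 by its difference with q times the column of exponent a - 1
    of the same block; this is right multiplication by [shear].  The rows of
    the two equal points then vanish except in the two columns of exponent 0,
    where they form a 2 x 2 block of determinant - plucker x 0 (j+1).  The other
    rows acquire the factors t_i - q. *)
Lemma vander2_collision (x y : 'M[R]_(2, m.+2)) :
  vander2 x t * vander2 y t =
  plucker x ord0 (lift ord0 j) * plucker y ord0 (lift ord0 j) *
  (\prod_(l < m) (q - t (drop2 j l))) ^+ 2 *
  (vander2 (colsub (drop2 j) x) (t \o drop2 j) *
   vander2 (colsub (drop2 j) y) (t \o drop2 j)).
Proof.
have det_eq z : vander2 z t = \det (reduced z).
  by rewrite -mul_shear det_mulmx det_shear mulr1.
rewrite !det_eq -(mul_det_mxsub _ _ _ rows_inj cols_inj) ?addn2 // !det_reduced.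
have -> : \prod_(l < m) (q - t (drop2 j l)) = \prod_(l < m) (t (drop2 j l) - q).
  rewrite (eq_bigr (fun l => - (t (drop2 j l) - q))) => [|l _]; last by rewrite opprB.
  by rewrite prodrN card_ord exprD -expr2 sqrr_sign mul1r.
ring.
Qed.
End Collision.

(** * Okada's pfaffian *)

Section Differences.
Variable R : comNzRingType.

Definition diffprod m (t : 'I_m -> R) : R :=
  \prod_(i < m) \prod_(l < m | (i < l)%N) (t i - t l).

Lemma eq_diffprod m (t u : 'I_m -> R) : t =1 u -> diffprod t = diffprod u.
Proof.
by move=> tu; apply: eq_bigr => i _; apply: eq_bigr => l _; rewrite !tu.
Qed.

Lemma diffprod_recl m (t : 'I_m.+1 -> R) :
  diffprod t = (\prod_l (t ord0 - t (lift ord0 l))) * diffprod (t \o lift ord0).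
Proof.
rewrite /diffprod big_ord_recl big_mkcond big_ord_recl /= mul1r.
congr (_ * _); apply: eq_bigr => i _.
by rewrite big_mkcond big_ord_recl /= mul1r [RHS]big_mkcond.
Qed.

Lemma diffprod_lift m (t : 'I_m.+1 -> R) (j : 'I_m.+1) :
  diffprod t =
  (-1) ^+ j * (\prod_l (t j - t (lift j l))) * diffprod (t \o lift j).
Proof.
elim: m => [|m IHm] in t j *.
  rewrite ord1 expr0 big_ord0 !mul1r diffprod_recl big_ord0 mul1r.
  exact: eq_diffprod.
case: (unliftP ord0 j) => [j' ->|->]; last first.
  by rewrite expr0 mul1r diffprod_recl.
have liftS l : lift (lift ord0 j') (lift ord0 l) = lift ord0 (lift j' l).
  by apply: val_inj; rewrite /= /bump /= !add1n ltnS addnS.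
have lift0 : lift (lift ord0 j') ord0 = ord0 by apply: val_inj.
rewrite diffprod_recl (IHm _ j') (bigD1_ord j') //= diffprod_recl big_ord_recl /=.
rewrite lift0 /bump /= add1n exprS.
under [X in _ = _ * (_ * X) * _]eq_bigr => l _ do rewrite liftS.
under [X in _ = _ * (X * _)]eq_bigr => l _ do rewrite liftS.
have -> : diffprod ((t \o lift (lift ord0 j')) \o lift ord0) =
    diffprod ((t \o lift ord0) \o lift j').
  by apply: eq_diffprod => l /=; rewrite liftS.
by ring.
Qed.

End Differences.

Section Okada.
Variable K : fieldType.

Lemma eq_vander2 (R : comNzRingType) m (x : 'M[R]_(2, m)) (t u : 'I_m -> R) :
  t =1 u -> vander2 x t = vander2 x u.
Proof.
by move=> tu; congr (\det _); apply/matrixP=> i l; rewrite !mxE tu.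
Qed.

Definition set0th m (t : 'I_m.+1 -> K) (z : K) (i : 'I_m.+1) : K :=
  if i == ord0 then z else t i.

(** Only the first row of the matrix involves t_0, and in it the exponents are
    at most s. *)
Lemma vander2_poly s m (x : 'M[K]_(2, m.+2)) (t : 'I_m.+2 -> K) :
    m = (s + s)%N ->
  exists2 f : {poly K}, (size f <= s.+1)%N &
    forall z, f.[z] = vander2 x (set0th t z).
Proof.
move=> em; have half : m./2.+1 = s.+1 by rewrite em addnn doubleK.
exists (\sum_(l < m.+2) ((if (l < s.+1)%N then x 1 ord0 else x 0 ord0) *
          cofactor (vander2_mx x t) ord0 l) *: 'X^(l %% s.+1)).
  apply: (leq_trans (size_sum _ _ _)); apply/bigmax_leqP => l _.
  by rewrite (leq_trans (size_scale_leq _ _)) // size_polyXn ltn_pmod.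
move=> z; rewrite horner_sum /vander2 (expand_det_row _ ord0).
apply: eq_bigr => l _; rewrite hornerZ hornerXn mxE /= half /set0th eqxx.
rewrite mulrAC; congr (_ * _ * _); rewrite /cofactor; congr (_ * \det _).
by apply/matrixP => i h; rewrite !mxE.
Qed.

(** Okada's identity, by Lagrange interpolation in t_0: the sign (-1)^j of the
    Laplace expansion cancels against the sign which appears when the factors
    containing t_(j+1) are extracted from the product of differences. *)
Lemma pfaffian_vander2 s m (x y : 'M[K]_(2, m)) (t : 'I_m -> K) :
    m = (s + s)%N -> injective t ->
  pfaffian (\matrix_(i, l) (plucker x i l * plucker y i l / (t i - t l))) *
    diffprod t = vander2 x t * vander2 y t.
Proof.
elim: s m x y t => [|s IHs] m x y t em tI.
  by subst m; rewrite /vander2 !det_mx00 /= /diffprod big_ord0.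
have {em} em : m = (s + s).+2 by rewrite em addSn addnS.
subst m; set m := (s + s)%N in x y t tI *.
pose psi (j : 'I_m.+1) := vander2 (colsub (drop2 j) x) (t \o drop2 j) *
              vander2 (colsub (drop2 j) y) (t \o drop2 j).
pose c (j : 'I_m.+1) := plucker x ord0 (lift ord0 j) * plucker y ord0 (lift ord0 j) *
  (\prod_(l < m) (t (lift ord0 j) - t (drop2 j l))) * psi j.
have lhs : pfaffian
    (\matrix_(i, l) (plucker x i l * plucker y i l / (t i - t l))) *
    diffprod t = \sum_j c j * \prod_(l < m) (t ord0 - t (drop2 j l)).
  rewrite /= mulr_suml; apply: eq_bigr => j _.
  rewrite diffprod_recl (bigD1_ord j) //= (diffprod_lift _ j) /c /psi /=.
  rewrite -(IHs m (colsub (drop2 j) x) (colsub (drop2 j) y) (t \o drop2 j)) //; last first.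
    by move=> a b /tI /lift_inj /lift_inj.
  have -> : mxsub (fun i => lift ord0 (lift j i)) (fun i => lift ord0 (lift j i))
      (\matrix_(i, l) (plucker x i l * plucker y i l / (t i - t l))) =
    \matrix_(i, l) (plucker (colsub (drop2 j) x) i l *
      plucker (colsub (drop2 j) y) i l / ((t \o drop2 j) i - (t \o drop2 j) l)).
    by apply/matrixP=> a b; rewrite !mxE /plucker !mxE.
  rewrite mxE.
  have d0 : t ord0 - t (lift ord0 j) != 0.
    by rewrite subr_eq0 (inj_eq tI) neq_lift.
  have -> : diffprod ((t \o lift ord0) \o lift j) = diffprod (t \o drop2 j) by [].
  set e := (-1) ^+ _; have e2 : e * e = 1 by rewrite -expr2 sqrr_sign.
  by move: e e2 => e e2; field: e2.
rewrite lhs.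
have [f szf fE] := vander2_poly x t (erefl m).
have [g szg gE] := vander2_poly y t (erefl m).
have tset : set0th t (t ord0) =1 t.
  by move=> i; rewrite /set0th; case: eqP => // ->.
rewrite -(eq_vander2 x tset) -(eq_vander2 y tset) -fE -gE -hornerM.
pose h := \sum_j c j *: \prod_(l < m) ('X - (t (drop2 j l))%:P).
have hE z : h.[z] = \sum_j c j * \prod_(l < m) (z - t (drop2 j l)).
  rewrite horner_sum; apply: eq_bigr => j _; rewrite hornerZ horner_prod.
  by congr (_ * _); apply: eq_bigr => l _; rewrite hornerXsubC.
rewrite -hE; suff -> : h = f * g by [].
apply/eqP; rewrite -subr_eq0; apply/eqP.
apply: (@roots_geq_poly_eq0 _ _ [seq t (lift ord0 j) | j <- enum 'I_m.+1]).
- apply/allP=> _ /mapP[j _ ->]; rewrite rootE hornerD hornerN hE hornerM fE gE.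
  rewrite (vander2_collision (j := j)); last first.
    by rewrite /set0th eqxx eq_sym (negbTE (neq_lift _ _)).
  have tdrop i : set0th t (t (lift ord0 j)) \o drop2 i =1 t \o drop2 i.
    by [].

  rewrite !(eq_vander2 _ (tdrop j)) (bigD1 j) //= [X in _ + X - _]big1 ?addr0 => [|i ij]; last first.
    have [l ->] : exists l, j = lift i l.
      by case: (unliftP i j) ij => [l -> _|->]; [exists l | rewrite eqxx].
    by rewrite (bigD1 l) //= /drop2 subrr mul0r mulr0.
  set z := t (lift ord0 j).
  have -> : \prod_(l < m) (set0th t z ord0 - set0th t z (drop2 j l)) =
      \prod_(l < m) (z - t (drop2 j l)) by apply: eq_bigr.
  by rewrite /c /psi subr_eq0; apply/eqP; ring.
- rewrite map_inj_uniq ?enum_uniq //.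
  by move=> a b /tI /lift_inj.
- rewrite size_map size_enum_ord (leq_trans (size_polyD _ _)) // geq_max.
  apply/andP; split.
    apply: (leq_trans (size_sum _ _ _)); apply/bigmax_leqP => j _.
    rewrite (leq_trans (size_scale_leq _ _)) // size_prod_XsubC.
    by rewrite /index_enum -enumT size_enum_ord.
  rewrite size_polyN (leq_trans (size_polyMleq _ _)) //.
  by have := leq_add szf szg; rewrite addSn addnS; case: (_ + _)%N.
Qed.
End Okada.

(** * The pfaffians F_B for different y *)

Definition hvander2_mx (R : comNzRingType) m (x p : 'M[R]_(2, m)) : 'M[R]_m :=
  \matrix_(r < m, j < m)
    ((if (j < m./2)%N then x 1 r else x 0 r) *
      p 1 r ^+ (m./2.-1 - j %% m./2) * p 0 r ^+ (j %% m./2)).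

Definition hvander2 (R : comNzRingType) m (x p : 'M[R]_(2, m)) : R :=
  \det (hvander2_mx x p).

Definition pluckerpf (K : fieldType) m (x y p : 'M[K]_(2, m)) : 'M[K]_m :=
  \matrix_(i, l) (plucker x i l * plucker y i l / plucker p i l).

Section Morphisms.
Variables (R S : comNzRingType) (f : {rmorphism R -> S}).

Lemma map_pfaffian m (A : 'M[R]_m) : pfaffian (map_mx f A) = f (pfaffian A).
Proof.
have [h] := ubnP m; elim: h => // h IHh in m A *.
case: m A => [|[|m]] A hm /=; [by rewrite rmorph1 | by rewrite rmorph0 |].
rewrite rmorph_sum; apply: eq_bigr => j _.
by rewrite !rmorphM rmorph_sign mxE -map_mxsub IHh // ltnW.
Qed.

Lemma map_plucker m (x : 'M[R]_(2, m)) i j :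
  plucker (map_mx f x) i j = f (plucker x i j).
Proof. by rewrite /plucker !mxE rmorphB !rmorphM. Qed.

Lemma map_hvander2 m (x p : 'M[R]_(2, m)) :
  hvander2 (map_mx f x) (map_mx f p) = f (hvander2 x p).
Proof.
rewrite /hvander2 -det_map_mx; congr (\det _); apply/matrixP=> i j.
by rewrite !mxE !rmorphM !rmorphXn; case: ifP.
Qed.

End Morphisms.

Lemma pfaffianZ (R : comNzRingType) m (a : R) (A : 'M[R]_m) :
  pfaffian (a *: A) = a ^+ m./2 * pfaffian A.
Proof.
have [h] := ubnP m; elim: h => // h IHh in m A *.
case: m A => [|[|m]] A hm /=; [by rewrite mulr1 | by rewrite mulr0 |].
rewrite mulr_sumr; apply: eq_bigr => j _.
have -> : mxsub (fun i => lift ord0 (lift j i)) (fun i => lift ord0 (lift j i))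
    (a *: A) =
    a *: mxsub (fun i => lift ord0 (lift j i)) (fun i => lift ord0 (lift j i)) A.
  by apply/matrixP=> i l; rewrite !mxE.
by rewrite mxE IHh 1?ltnW // exprS; ring.
Qed.

Lemma diffprod_neq0 (K : fieldType) m (t : 'I_m -> K) :
  injective t -> diffprod t != 0.
Proof.
move=> tI; apply/prodf_neq0 => i _; apply/prodf_neq0 => l il.
by rewrite subr_eq0 (inj_eq tI) neq_ltn il.
Qed.

(** Each row of the matrix is homogeneous of degree s - 1 in the
    coordinates of p. *)
Lemma hvander2_affine (K : fieldType) s m (x p : 'M[K]_(2, m)) :
    m = (s + s)%N -> (forall i, p 1 i != 0) ->
  hvander2 x p =
  (\prod_i p 1 i ^+ s.-1) * vander2 x (fun i => p 0 i / p 1 i).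
Proof.
move=> em p1; have half : m./2 = s by rewrite em addnn doubleK.
have -> : \prod_i p 1 i ^+ s.-1 = \det (diag_mx (\row_i (p 1 i ^+ s.-1))).
  by rewrite det_diag; apply: eq_bigr => i _; rewrite mxE.
rewrite /vander2 -det_mulmx; congr (\det _); apply/matrixP=> i l.
rewrite mul_diag_mx !mxE half.
have s0 : (0 < s)%N by have := ltn_ord l; lia.
have lts : (l %% s <= s.-1)%N by rewrite -ltnS prednK ?ltn_pmod.
rewrite expr_div_n -[in RHS](subnK lts) exprD; field.
by rewrite expf_neq0.
Qed.

Lemma pfaffian_ratio_affine (K : fieldType) s m (x y c p : 'M[K]_(2, m)) :
    m = (s + s)%N -> (forall i, p 1 i != 0) ->
    (forall i l, i != l -> plucker p i l != 0) ->
  pfaffian (pluckerpf x y p) * hvander2 c p =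
  pfaffian (pluckerpf x c p) * hvander2 y p.
Proof.
move=> em p1 pp; pose t i := p 0 i / p 1 i.
have pE i l : plucker p i l = p 1 i * p 1 l * (t i - t l).
  by rewrite /plucker /t; field; rewrite !p1.
have tI : injective t.
  move=> i l til; apply/eqP/negPn/negP => /pp.
  by rewrite pE til subrr mulr0 eqxx.
(* The scaling of the columns of p is absorbed by the columns of x. *)
pose x' : 'M[K]_(2, m) := \matrix_(r, i) (x r i / p 1 i).
have pfE z : pfaffian (pluckerpf x z p) * diffprod t = vander2 x' t * vander2 z t.
  rewrite -(pfaffian_vander2 _ _ em tI); congr (pfaffian _ * _).
  apply/matrixP=> i l; rewrite !mxE pE {1 3}/plucker !mxE !invfM.
  move: (t i - t l)^-1 => w; field.
  by rewrite !p1.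
apply: (mulIf (diffprod_neq0 tI)).
rewrite !(hvander2_affine _ em p1) -/t.
by rewrite mulrAC pfE [RHS]mulrAC pfE; ring.
Qed.

(** Columns of p with second coordinate 0 are avoided by passing to
    p_i + 'X P_i over the field of fractions of K['X]: this leaves all p_ij
    unchanged, and p is recovered at 'X = 0. *)
Lemma pfaffian_ratio (K : fieldType) s m (x y c p : 'M[K]_(2, m)) :
    m = (s + s)%N -> (forall i l, i != l -> plucker p i l != 0) ->
  pfaffian (pluckerpf x y p) * hvander2 c p =
  pfaffian (pluckerpf x c p) * hvander2 y p.
Proof.
move=> em pp.
pose P : 'M[{poly K}]_(2, m) :=
  \matrix_(r, i) ((p r i)%:P + (if r == 0 then 0 else (p 0 i)%:P * 'X)).
have PE i l : plucker P i l = (plucker p i l)%:P.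
  by rewrite /plucker !mxE /= polyCB !polyCM; ring.
(* A zero column of p is excluded by p_il != 0, where l is 0 or 1. *)
have P1 i : P 1 i != 0.
  have [l il] : exists l : 'I_m, i != l.
    have lt : ((i == 0%N :> nat) < m)%N.
      by have := ltn_ord i; case: eqP => /=; lia.
    exists (Ordinal lt); rewrite -val_eqE /=; by case: (i : nat).
  apply: contraNneq (pp _ _ il); rewrite mxE /= => P0.
  have /(congr1 (coefp 0)) := P0; have /(congr1 (coefp 1)) := P0.
  rewrite /coefp !coefD !coefCM !coefC !coefX /= mulr0 mulr1 !addr0 add0r.
  by move=> a b; rewrite /plucker a b; apply/eqP; ring.
pose f := (@tofrac {poly K}) \o (@polyC K).
have frac_inj (u v : {poly K}) : tofrac u = tofrac v -> u = v.
  by move/eqP; rewrite tofrac_eq => /eqP.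
have pfE z : pluckerpf (map_mx f x) (map_mx f z) (map_mx (@tofrac _) P) =
    map_mx f (pluckerpf x z p).
  by apply/matrixP=> i l; rewrite !mxE !map_plucker PE -!rmorphM -fmorph_div.
have hvE z : hvander2 (map_mx f z) (map_mx (@tofrac _) P) =
    tofrac (hvander2 (map_mx polyC z) P).
  by rewrite -map_hvander2 -map_mx_comp.
have hv0 z : (hvander2 (map_mx polyC z) P).[0] = hvander2 z p.
  rewrite -[LHS]/(horner_eval 0 _) -map_hvander2; congr hvander2.
    by apply/matrixP=> r i; rewrite !mxE /= /horner_eval hornerC.
  apply/matrixP=> r i; rewrite !mxE /= /horner_eval hornerD hornerC.
  by case: ifP => _; rewrite ?horner0 ?hornerM ?hornerX ?mulr0 addr0.
have /= := @pfaffian_ratio_affine _ s m (map_mx f x) (map_mx f y) (map_mx f c)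
  (map_mx (@tofrac _) P) em.
rewrite !pfE !hvE !map_pfaffian /= -!rmorphM => H.
have P1L i : map_mx (@tofrac _) P 1 i != 0 by rewrite mxE tofrac_eq0.
have PpL i l : i != l -> plucker (map_mx (@tofrac _) P) i l != 0.
  by move=> il; rewrite map_plucker PE tofrac_eq0 polyC_eq0 pp.
have /frac_inj/(congr1 (horner_eval 0)) := H P1L PpL.
by rewrite /horner_eval !hornerM !hornerC !hv0.
Qed.

(** * Closed embeddings of spectra *)

Section Embedding.
Variables (k : closedFieldType) (N : nat).

Lemma meval_unique (psi : {mpoly k[N]} -> k) :
    (forall c, psi c%:MP = c) -> (forall g h, psi (g + h) = psi g + psi h) ->
    (forall g h, psi (g * h) = psi g * psi h) ->
  forall g, psi g = g.@[fun i => psi 'X_i].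
Proof.
move=> psiC psiD psiM g.
have psiX m : psi 'X_[m] = ('X_[m] : {mpoly k[N]}).@[fun i => psi 'X_i].
  rewrite mpolyXE_id; elim/big_ind: _ => [|u v hu hv|i _].
  - by rewrite -mpolyC1 psiC mevalC.
  - by rewrite psiM mevalM hu hv.
  - elim: (m i) => [|e IHe]; first by rewrite !expr0 -mpolyC1 psiC mevalC.
    by rewrite !exprS psiM mevalM IHe mevalXU.
elim/mpolyind: g => [|c m p _ _ IHp]; first by rewrite -mpolyC0 psiC mevalC.
by rewrite psiD mevalD IHp -mul_mpolyC psiM mevalM psiC mevalC psiX.
Qed.

Lemma kpoint_meval (S : comNzRingType) (iS : k -> S) (A : S -> Prop)
    (phi : {mpoly k[N]} -> S) (chi : S -> k) :
    alg_hom (fun c => c%:MP) iS (full (R:={mpoly k[N]})) A phi ->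
    kpoint iS A chi ->
  forall g, chi (phi g) = g.@[fun i => chi (phi 'X_i)].
Proof.
case=> phiA phiC phiD phiM [_ chiC chiD chiM].
apply: (meval_unique (psi := chi \o phi)) => [c|g h|g h] /=.
- by rewrite phiC chiC.
- by rewrite phiD // chiD //; apply: phiA.
- by rewrite phiM // chiM //; apply: phiA.
Qed.

(** The k-points of an algebra presented by phi are the zeros of the kernel of
    phi: the point v gives the character phi g |-> g(v), which is well defined
    as soon as the kernel vanishes at v. *)
Lemma epi_closed_embedding (S : comNzRingType) (iS : k -> S) (A : S -> Prop)
    (phi : {mpoly k[N]} -> S) (I : {mpoly k[N]} -> Prop) :
    alg_epi (fun c => c%:MP) iS (full (R:={mpoly k[N]})) A phi ->
    (forall g, I g -> phi g = 0) ->
  spec_closed_embedding iS A phi I.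
Proof.
move=> epi I0; have [hom onto] := epi; have [phiA phiC phiD phiM] := hom.
have chi0 chi : kpoint iS A chi -> chi 0 = 0.
  move=> chiP; have phi0 : phi 0 = 0.
    by apply: (@addrI _ (phi 0)); rewrite -phiD // !addr0.
  by have := kpoint_meval hom chiP 0; rewrite phi0 meval0.
split=> //.
- by move=> chi chiP g Ig; rewrite -(kpoint_meval hom chiP) I0 ?chi0.
- move=> chi1 chi2 P1 P2 e a /onto [g _ <-].
  rewrite (kpoint_meval hom P1) (kpoint_meval hom P2).
  by apply: meval_eq => i; apply: e.
move=> v; split=> [vZ|[chi chiP e] g phig0]; last first.
  rewrite -(meval_eq (v1 := fun i => chi (phi 'X_i))) //.
  by rewrite -(kpoint_meval hom chiP) phig0 chi0.
pose chi a := (epsilon (inhabits 0) (fun g => phi g = a)).@[v].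
have chiE g : chi (phi g) = g.@[v].
  have := epsilon_spec (inhabits 0) (fun h => phi h = phi g) (ex_intro _ g erefl).
  rewrite /chi; set h := epsilon _ _ => e.
  have : phi (h - g) = 0.
    by apply: (@addIr _ (phi g)); rewrite -phiD // subrK add0r.
  by move/vZ; rewrite mevalB => /eqP; rewrite subr_eq0 => /eqP.
exists chi; last by move=> i; rewrite chiE mevalXU.
split=> [//|c|a b /onto[g _ <-] /onto[h _ <-]|a b /onto[g _ <-] /onto[h _ <-]].
- by rewrite -phiC chiE mevalC.
- by rewrite -phiD // !chiE mevalD.
- by rewrite -phiM // !chiE mevalM.
Qed.

Lemma alg_epi_iso (S S' : comNzRingType) (iS : k -> S) (iS' : k -> S')
    (A : S -> Prop) (A' : S' -> Prop) (phi : {mpoly k[N]} -> S) (theta : S -> S') :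
    alg_epi (fun c => c%:MP) iS (full (R:={mpoly k[N]})) A phi ->
    alg_iso iS iS' A A' theta ->
  alg_epi (fun c => c%:MP) iS' (full (R:={mpoly k[N]})) A' (theta \o phi).
Proof.
move=> [[phiA phiC phiD phiM] onto] [[thA thC thD thM] _ thonto]; split.
  split=> [g _|c|g h _ _|g h _ _] /=.
  - exact/thA/phiA.
  - by rewrite phiC thC.
  - by rewrite phiD // thD //; apply: phiA.
  - by rewrite phiM // thM //; apply: phiA.
by move=> _ /thonto[_ /onto[g _ <-] <-]; exists g.
Qed.

Lemma iso_kernel (S S' : comNzRingType) (iS : k -> S) (iS' : k -> S')
    (A : S -> Prop) (A' : S' -> Prop) (phi : {mpoly k[N]} -> S) (theta : S -> S') :
    alg_epi (fun c => c%:MP) iS (full (R:={mpoly k[N]})) A phi ->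
    alg_iso iS iS' A A' theta ->
  forall g, kernel (theta \o phi) g <-> kernel phi g.
Proof.
move=> [[phiA _ phiD _] _] [[_ _ thD _] thI _] g.
have phi0 : phi 0 = 0 by apply: (@addrI _ (phi 0)); rewrite -phiD // !addr0.
have A0 : A 0 by rewrite -phi0; apply: phiA.
have th0 : theta 0 = 0 by apply: (@addrI _ (theta 0)); rewrite -thD // !addr0.
rewrite /kernel /=; split=> [|->] //; rewrite -th0; apply: thI => //.
exact: phiA.
Qed.

End Embedding.

Lemma subalg_gen_mmap (k : closedFieldType) (N : nat) (R : comNzRingType)
    (h : {rmorphism k -> R}) (v : 'I_N -> R) (G : R -> Prop) g :
  (forall i, G (v i)) -> subalg_gen h G (mmap h v g).
Proof.
move=> vG; have scal c : subalg_gen h G (h c) by apply: SubalgScalar.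
have one : subalg_gen h G 1 by rewrite -(rmorph1 h); apply: scal.
elim/mpolyind: g => [|c m g _ _ IHg].
  by rewrite -mpolyC0 mmapC; apply: scal.
rewrite mmapD mmapZ mmapX; apply: SubalgAdd; last exact: IHg.
apply: SubalgMul; first exact: scal.
rewrite /mmap1; elim/big_ind: _ => [|a b|i _]; [exact: one | exact: SubalgMul |].
elim: (m i) => [|e IHe]; first by rewrite expr0; apply: one.
by rewrite exprS; apply: SubalgMul => //; apply: SubalgGen.
Qed.

(** * Spinor relations between subpfaffians *)

Section Mmap.
Variables (k : comNzRingType) (N : nat).

Lemma rmorph_mmap (R S : comNzRingType) (f : {rmorphism R -> S})
    (h : {rmorphism k -> R}) (v : 'I_N -> R) (g : {mpoly k[N]}) :
  f (mmap h v g) = mmap (f \o h) (f \o v) g.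
Proof.
rewrite /mmap rmorph_sum; apply: eq_bigr => m _.
rewrite rmorphM /=; congr (_ * _); rewrite /mmap1 rmorph_prod.
by apply: eq_bigr => i _; rewrite rmorphXn.
Qed.

Lemma eq_mmap (R : comNzRingType) (h h' : k -> R) (v v' : 'I_N -> R)
    (g : {mpoly k[N]}) :
  h =1 h' -> v =1 v' -> mmap h v g = mmap h' v' g.
Proof.
move=> hh vv; apply: eq_bigr => m _; rewrite hh; congr (_ * _).
by apply: eq_bigr => i _; rewrite vv.
Qed.

Lemma mmap_homog (R : comNzRingType) (h : {rmorphism k -> R}) (a : R)
    (v : 'I_N -> R) d (g : {mpoly k[N]}) :
  g \is d.-homog -> mmap h (fun i => a * v i) g = a ^+ d * mmap h v g.
Proof.
move=> /dhomogP gd; rewrite /mmap mulr_sumr !big_seq; apply: eq_bigr => m mg.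
have <- : mdeg m = d := gd m mg.
rewrite mulrCA; congr (_ * _); rewrite /mmap1 mdegE -prodrXr -big_split /=.
by apply: eq_bigr => i _; rewrite exprMn.
Qed.

End Mmap.

Section Spinor.
Variables (k : closedFieldType) (n : nat).

(** Spinor relations are relations between the subpfaffians of the generic
    skew-symmetric matrix, hence hold for those of M.  Being generated by
    homogeneous elements, they also hold on the cone over them. *)
Lemma spin_ideal_pfaffian (R : comNzRingType) (h : {rmorphism k -> R})
    (M : 'M[R]_n) (a : R) g :
    (forall i, M i i = 0) -> (forall i j, M i j = - M j i) ->
    spin_ideal g ->
  mmap h (fun i => a * pfaffian_sub M (even_of i)) g = 0.
Proof.
move=> M0 Mskew [s sP ->]; rewrite rmorph_sum big_seq big1 // => u /sP [u0 [d ud]].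
rewrite rmorphM /= (mmap_homog _ _ _ ud).
pose z := mmap h (fun i => mxvec M 0 i).
have -> : mmap h (fun i => pfaffian_sub M (even_of i)) u.2 = z (spin_map u.2).
  rewrite /spin_map /z rmorph_mmap; apply: eq_mmap => [c|i] /=.
    by rewrite mmapC.
  rewrite /pfaffian_sub -map_pfaffian; congr pfaffian.
  apply/matrixP=> a' b; rewrite !mxE /=; move: (enum_val a') (enum_val b) => i' j.
  case: ltngtP => [ij|ij|/val_inj ->].
  - by rewrite mmapX mmap1U mxvecE.
  - by rewrite mmapN mmapX mmap1U mxvecE -Mskew.
  - by rewrite mmap0 M0.
by rewrite u0 /z mmap0 !mulr0.
Qed.

Lemma Psi_hvander2 (B : {set 'I_n}) (x p : 'M[k]_(2, n)) :
  Psi B x p = hvander2 (colsub (fun i : 'I_#|B| => enum_val i) x)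
                       (colsub (fun i : 'I_#|B| => enum_val i) p).
Proof.
congr (\det _); apply/matrixP=> i j; rewrite !mxE.
by case: ifP.
Qed.

End Spinor.

(** * The Gale dual *)

(** If p_ij = 0, then some nonzero vector of the row space of p vanishes at i
    and j.  It is a linear relation between n - 2 of the points Q_a, which are
    independent. *)
Lemma gale_dual_plucker_neq0 (k : closedFieldType) n (Q : 'M[k]_(n - 2, n))
    (p : 'M[k]_(2, n)) :
  linearly_general Q -> gale_dual Q p ->
  forall i j, i != j -> plucker p i j != 0.
Proof.
move=> Qgen [p2 pker] i j ij; apply/negP => /eqP pij.
pose M : 'M[k]_2 := \matrix_(r, c) p r (if c == 0 then i else j).
have /det0P[u u0 uM] : \det M == 0.
  by rewrite det_mx22 !mxE /= mulrC -pij /plucker; apply/eqP; ring.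
pose w := u *m p.
have wE (c : 'I_2) : w 0 (if c == 0 then i else j) = 0.
  by have := congr1 (fun v : 'rV_2 => v 0 c) uM; rewrite !mxE; under eq_bigr do rewrite mxE.
have wi : w 0 i = 0 := wE 0.
have wj : w 0 j = 0 := wE 1.
have w0 : w != 0.
  apply: contra u0 => /eqP w0; apply/eqP; apply: (row_free_inj (A := p)).
    by rewrite /row_free p2.
  by rewrite mul0mx.
have wQ : w *m Q^T = 0.
  by apply/sub_kermxP; rewrite -pker submxMl.
have cardC : #|~: [set i; j]| = (n - 2)%N.
  by rewrite cardsCs setCK card_ord cards2 ij.
pose f (a : 'I_(n - 2)) : 'I_n := enum_val (cast_ord (esym cardC) a).
have fI : injective f by move=> a b /enum_val_inj /cast_ord_inj.
have := Qgen f fI; rewrite unitmxE -det_tr -unitmxE => Qf.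
have wf : colsub f w *m (colsub f Q)^T = 0.
  apply/matrixP=> a b; have := congr1 (fun v : 'rV_(n - 2) => v 0 b) wQ.
  rewrite ord1 !mxE (bigID (mem (~: [set i; j]))) /= [X in _ + X]big1 ?addr0.
    rewrite (reindex f) => [E|].
      rewrite -[RHS]E; apply: eq_big => [c|c _]; last by rewrite !mxE.
      by rewrite /f enum_valP.
    exists (fun c => cast_ord cardC (enum_rank_in (enum_valP (cast_ord (esym cardC) b)) c)).
      by move=> c _; rewrite /f enum_valK_in cast_ordKV.
    by move=> c cP; rewrite /f cast_ordK enum_rankK_in.
  by move=> c; rewrite !inE negbK => /orP[]/eqP ->; rewrite ?wi ?wj mul0r.
have {}wf : colsub f w = 0.
  by rewrite -[LHS](mulmxK Qf) wf mul0mx.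
case/eqP: w0; apply/rowP=> c; rewrite [RHS]mxE.
have [cP|] := boolP (c \in ~: [set i; j]); last first.
  by rewrite !inE negbK => /orP[]/eqP ->.
have -> : c = f (cast_ord cardC (enum_rank_in cP c)).
  by rewrite /f cast_ordK enum_rankK_in.
by have := congr1 (fun v : 'rV_(n - 2) => v 0 (cast_ord cardC (enum_rank_in cP c))) wf; rewrite !mxE.
Qed.

(** * The presentation of the Cox ring *)

Lemma sum_polyXn_eq0 (R : nzRingType) D (w : 'I_D -> nat) (c : 'I_D -> R) :
  injective w -> \sum_e 'X^(w e) * (c e)%:P = 0 -> forall e, c e = 0.
Proof.
move=> wI sum0 e; have /(congr1 (fun q : {poly R} => q`_(w e))) := sum0.
rewrite coef0 coef_sum (bigD1 e) //= coefXnM ltnn subnn coefC /= big1 ?addr0 //.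
move=> h he; rewrite coefXnM coefC subn_eq0; case: ltnP => // le; case: leqP => // ge.
by move: he; rewrite -(inj_eq wI) eqn_leq le ge.
Qed.

Section CoxMap.
Variables (k : closedFieldType) (n : nat).

Lemma even_ofP (i : 'I_(nevens n)) : #|even_of i| = (#|even_of i|./2 + #|even_of i|./2)%N.
Proof.
have := enum_valP i; rewrite inE addnn => ev.
by rewrite -[LHS]odd_double_half (negbTE ev).
Qed.

(** Up to a factor that depends on p and B only, F_B(x,y,p) is
    Psi_B(x,p) Psi_B(y,p).  Hence replacing y by c multiplies F_B by
    Psi_B(c,p) / Psi_B(y,p), which is the coordinate a(c)_B. *)
Lemma Fpf_ratio (y c p : 'M[k]_(2, n)) (i : 'I_(nevens n)) :
    (forall a b, a != b -> plucker p a b != 0) ->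
  Psi (even_of i) c p *: Fpf (even_of i) y p =
  Psi (even_of i) y p *: Fpf (even_of i) c p.
Proof.
move=> pp; set B := even_of i; pose e (a : 'I_#|B|) : 'I_n := enum_val a.
pose F := {fraction {mpoly k[n + n]}}.
pose f : {rmorphism {mpoly k[n + n]} -> F} := @tofrac {mpoly k[n + n]}.
pose h : {rmorphism k -> F} := f \o @mpolyC (n + n) k.
have pfE z : f (Fpf B z p) = pfaffian (pluckerpf (map_mx f (colsub e (xgen k n)))
    (map_mx h (colsub e z)) (map_mx h (colsub e p))).
  rewrite /Fpf /pfaffian_sub -map_pfaffian; congr pfaffian; apply/matrixP=> a b.
  rewrite !mxE !map_plucker -mul_mpolyC rmorphM -mulrA -fmorph_div.
  rewrite mulrC; congr (_ * h (_ / _)); rewrite /plucker !mxE //.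
have hvE z : hvander2 (map_mx h (colsub e z)) (map_mx h (colsub e p)) =
    h (Psi B z p).
  by rewrite map_hvander2 -Psi_hvander2.
apply/eqP; rewrite -(tofrac_eq (R := {mpoly k[n + n]})) -!mul_mpolyC !rmorphM.
rewrite ![tofrac (mpolyC _ _) * _]mulrC !pfE -[tofrac _]/(h _) -[X in _ == _ * X]/(h _).
rewrite -!hvE; apply/eqP; apply: (pfaffian_ratio _ _ _ (even_ofP i)) => a b ab.
by rewrite map_plucker fmorph_eq0 /plucker !mxE pp // (inj_eq enum_val_inj).
Qed.

HB.instance Definition _ := GRing.RMorphism.copy (@constxT k n)
  (@tofrac {poly {mpoly k[n + n]}} \o (@polyC {mpoly k[n + n]} \o @mpolyC (n + n) k)).

Variables (p : 'M[k]_(2, n)).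

HB.instance Definition _ (y : 'M[k]_(2, n)) :=
  GRing.RMorphism.copy (cox_map y p) (mmap (constxT n) (cox_gen y p)).

Lemma cox_map_epi y :
  alg_epi (fun c => c%:MP) (constxT n) (full (R:={mpoly k[nevens n]}))
    (cox_subalg y p) (cox_map y p).
Proof.
have mapC c : cox_map y p c%:MP = constxT n c by rewrite /cox_map mmapC.
have mapX i : cox_map y p 'X_i = cox_gen y p i by rewrite /cox_map mmapX mmap1U.
split; last first.
  move=> b; elim=> {b} [c|_ [i ->]|_ _ _ [g _ <-] _ [h _ <-]|_ _ _ [g _ <-] _ [h _ <-]].
  - by exists c%:MP.
  - by exists 'X_i.
  - by exists (g + h); rewrite ?rmorphD.
  - by exists (g * h); rewrite ?rmorphM.
split=> [g _|//|g h _ _|g h _ _]; rewrite ?rmorphD ?rmorphM //.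
by apply: (subalg_gen_mmap (constxT n)) => i; exists i.
Qed.

Let T : fieldxT k n := tofrac 'X.

Let T0 : T != 0.
Proof. by rewrite tofrac_eq0 polyX_eq0. Qed.

Lemma spin_ideal_cox_map y g : spin_ideal g -> cox_map y p g = 0.
Proof.
move=> gI; pose M0 : 'M[{mpoly k[n + n]}]_n := \matrix_(i, j)
  ((plucker y i j / plucker p i j) *: plucker (xgen k n) i j).
pose f : {rmorphism {mpoly k[n + n]} -> fieldxT k n} :=
  @tofrac {poly {mpoly k[n + n]}} \o @polyC {mpoly k[n + n]}.
pose M := T^-1 *: map_mx f M0.
have pl0 (R : comNzRingType) (x : 'M[R]_(2, n)) i : plucker x i i = 0.
  by rewrite /plucker subrr.
have plN (R : comNzRingType) (x : 'M[R]_(2, n)) i j : plucker x i j = - plucker x j i.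
  by rewrite /plucker opprB.
rewrite -[RHS](@spin_ideal_pfaffian _ _ _ (constxT n) M T g) //; first last.
- move=> i j; rewrite !mxE -mulrN -rmorphN; congr (_ * f _).
  rewrite (plN _ y) (plN _ p) (plN _ (xgen k n)) invrN mulrNN.
  by rewrite scalerN.
- by move=> i; rewrite !mxE pl0 mul0r scale0r rmorph0 mulr0.
apply: eq_mmap => // i; rewrite /cox_gen /pfaffian_sub -/T.
set e := fun _ => _; have -> : mxsub e e M = T^-1 *: map_mx f (mxsub e e M0).
  by apply/matrixP=> a b; rewrite !mxE.
rewrite pfaffianZ map_pfaffian mulrA; congr (_ * _).
by rewrite expfzDr // expr1z exprVn exprnN.
Qed.

Lemma cox_gen_avec y c i :
    (forall a b, a != b -> plucker p a b != 0) -> calG p y ->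
  constxT n (avec y p c i) * cox_gen y p i = cox_gen c p i.
Proof.
move=> pp [_ yG]; have Psi0 : Psi (even_of i) y p != 0 by apply/yG/enum_valP.
rewrite /cox_gen mulrCA; congr (_ * _); rewrite /constxT -!rmorphM; congr (tofrac (polyC _)).
rewrite mul_mpolyC /avec mulrC -scalerA (Fpf_ratio _ _ _ pp) scalerA.
by rewrite mulVf ?scale1r.
Qed.

Lemma scale_spin_ideal_cox_map y c g :
    (forall a b, a != b -> plucker p a b != 0) -> calG p y ->
    scale_ideal (avec y p c) (@spin_ideal k n) g ->
  cox_map y p g = 0.
Proof.
move=> pp yG [g' g'I ->].
rewrite /comp_mpoly rmorph_mmap -[RHS](spin_ideal_cox_map c g'I).
apply: eq_mmap => [a|i] /=; first by rewrite /cox_map mmapC.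
rewrite tnth_mktuple -mul_mpolyC rmorphM /= /cox_map mmapC mmapX mmap1U.
exact: cox_gen_avec.
Qed.

Lemma cox_kernel_prime y : prime_ideal (kernel (cox_map y p)).
Proof.
rewrite /kernel; split=> [|f g g0||f g].
- split=> [|f g f0 g0]; first by rewrite rmorph0.
  by rewrite rmorphD [X in X + _]f0 [X in _ + X]g0 addr0.
- by rewrite rmorphM [X in _ * X]g0 mulr0.
- by rewrite rmorph1; apply/eqP/oner_neq0.
- by rewrite rmorphM => /eqP; rewrite mulf_eq0 => /orP[]/eqP; [left | right].
Qed.

Section Homogeneous.
Variable y : 'M[k]_(2, n).

Let A := {poly {mpoly k[n + n]}}.
Let cst : k -> A := @polyC {mpoly k[n + n]} \o @mpolyC (n + n) k.

(** The generators of the Cox ring multiplied by T^n, which makes them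
    polynomials in T. *)
Let gen (i : 'I_(nevens n)) : A :=
  'X^(n.+1 - #|even_of i|./2) * (Fpf (even_of i) y p)%:P.

Let half_card_le (i : 'I_(nevens n)) : (#|even_of i|./2 <= n)%N.
Proof.
have le : (#|even_of i| <= n)%N by rewrite -[X in (_ <= X)%N]card_ord max_card.
by rewrite (leq_trans _ le) // [X in (_ <= X)%N]even_ofP leq_addr.
Qed.

Let tofrac_gen i : tofrac (gen i) = T ^+ n * cox_gen y p i.
Proof.
rewrite /gen rmorphM rmorphXn mulrA; congr (_ * _).
have le := half_card_le i.
rewrite !exprnP -expfzDr //; congr (_ ^ _); lia.
Qed.

(** [sigma] extends [rho] by T |-> u^2 T, u being the outer variable 'X.  It
    multiplies an element of degree e by u^e, for the grading in which the
    variables X_i and x_i have degree 1 and T has degree 2. *)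
Let rho : {rmorphism {mpoly k[n + n]} -> {poly A}} :=
  mmap (@polyC A \o cst) (fun i => 'X * ((('X_i)%:P : A)%:P)).

Let rho_comm : commr_rmorph rho ('X^2 * ('X : A)%:P).
Proof. by move=> a; apply: mulrC. Qed.

Let sigma : {rmorphism A -> {poly A}} := horner_morph rho_comm.

Let rho_Fpf B : rho (Fpf B y p) = 'X^(2 * #|B|./2) * ((Fpf B y p)%:P)%:P.
Proof.
rewrite /Fpf /pfaffian_sub exprM; set M := mxsub _ _ _.
pose pC : {rmorphism {mpoly k[n + n]} -> {poly A}} := @polyC A \o @polyC _.
rewrite -[((pfaffian M)%:P)%:P]/(pC (pfaffian M)) -(map_pfaffian rho).
rewrite -(map_pfaffian pC) -pfaffianZ; congr pfaffian; apply/matrixP=> a b.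
rewrite !mxE; move: (_ / _) => w; rewrite -mul_mpolyC /plucker !mxE.
rewrite !(rmorphM, rmorphB) /= !mmapX !mmap1U mmapC /cst /=.
have bilin (R : comNzRingType) (u w' x1 x2 x3 x4 : R) :
  w' * (u * x1 * (u * x2) - u * x3 * (u * x4)) = u ^+ 2 * (w' * (x1 * x2 - x3 * x4)).
  by ring.
exact: bilin.
Qed.

Let sigma_gen i : sigma (gen i) = 'X^(2 * n.+1) * (gen i)%:P.
Proof.
rewrite /gen rmorphM /sigma rmorphXn /= horner_morphX horner_morphC rho_Fpf.
have le := half_card_le i.
rewrite exprMn -exprM polyCM mulrACA -exprD -mulnDr subnK 1?ltnW //.
by rewrite polyC_exp.
Qed.

(** For this grading the polynomials [gen i] all have degree 2 (n + 1).  If g_e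
    is the component of degree e of g and D exceeds all the e, then
    T^(n D) cox_map g is the sum of the T^(n (D - e)) phi(g_e), where phi sends
    f_B to [gen].  The terms have the distinct degrees 2 (n D + e), hence vanish
    separately when the sum does. *)
Lemma cox_kernel_homogeneous : homogeneous_ideal (kernel (cox_map y p)).
Proof.
move=> g d g0; rewrite /kernel.
pose phi := mmap cst gen.
have phiE e (h : {mpoly k[nevens n]}) : h \is e.-homog ->
    tofrac (phi h) = T ^+ (n * e) * cox_map y p h.
  move=> he; rewrite exprM -(mmap_homog _ _ _ he) rmorph_mmap.
  by apply: eq_mmap => // i /=; apply: tofrac_gen.
have sigma_phi e (h : {mpoly k[nevens n]}) : h \is e.-homog ->
    sigma (phi h) = 'X^(2 * n.+1 * e) * (phi h)%:P.
  move=> he; rewrite [in RHS]exprM -[(phi h)%:P]/(polyC (phi h)).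
  rewrite (rmorph_mmap (@polyC A)) -(mmap_homog _ _ _ he) rmorph_mmap.
  apply: eq_mmap => [c|i] /=; last exact: sigma_gen.
  by rewrite /cst /sigma /= horner_morphC /rho /= mmapC.
pose D := maxn (msize g) d.+1.
have gE := pihomog_partitionE (leq_maxl (msize g) d.+1).
have sum0 : \sum_(e < D) 'X^(n * (D - e)) * phi (pihomog mdeg e g) = 0.
  apply/eqP; rewrite -(tofrac_eq0 (R := A)) rmorph_sum /=; apply/eqP.
  transitivity (T ^+ (n * D) * cox_map y p g); last by rewrite [X in _ * X]g0 mulr0.
  rewrite [X in cox_map y p X]gE rmorph_sum mulr_sumr.
  apply: eq_bigr => e _; rewrite rmorphM rmorphXn /= (phiE e) ?pihomogP //.
  by rewrite mulrA -exprD -mulnDr subnK // ltnW.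
have dD : (d < D)%N by rewrite leq_maxr.
have term (e : 'I_D) : sigma ('X^(n * (D - e)) * phi (pihomog mdeg e g)) =
    'X^(2 * (n * D + e)) * ('X^(n * (D - e)) * phi (pihomog mdeg e g))%:P.
  rewrite rmorphM rmorphXn (sigma_phi e) ?pihomogP // /sigma /= horner_morphX.
  rewrite exprMn -exprM polyCM mulrACA -exprD polyC_exp; congr ('X^_ * _).
  rewrite -!mulnA -mulnDr; congr (2 * _)%N.
  by rewrite mulSn addnCA -mulnDr subnK 1?ltnW // addnC.
have sum1 : \sum_(e < D) 'X^(2 * (n * D + e)) *
    ('X^(n * (D - e)) * phi (pihomog mdeg e g))%:P = 0.
  transitivity (sigma (\sum_(e < D) 'X^(n * (D - e)) * phi (pihomog mdeg e g))).
    by rewrite rmorph_sum; apply: eq_bigr => e _; rewrite term.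
  by rewrite sum0 rmorph0.
have wI : injective (fun e : 'I_D => 2 * (n * D + e))%N.
  by move=> a b /eqP; rewrite eqn_mul2l eqn_add2l => /eqP /val_inj.
have /eqP := sum_polyXn_eq0 wI sum1 (Ordinal dD).
rewrite mulf_eq0 expf_eq0 polyX_eq0 andbF orFb => /eqP phi0.
have := phiE d _ (pihomogP _ d g).
rewrite phi0 rmorph0 => /esym/eqP; rewrite mulf_eq0 expf_eq0 (negbTE T0) andbF orFb.
by move/eqP.
Qed.
End Homogeneous.
End CoxMap.

(* I_X is the kernel of [cox_map y p].  The second conclusion transports the
   embedding along any identification theta of the algebra generated by the
   T^(1 - |B|/2) F_B(x,y,p) with the Cox ring of X_n(Q). *)
Theorem theorem1p1 (k : closedFieldType) (n : nat) (hn : (5 <= n)%N)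
    (Q : 'M[k]_(n - 2, n)) (hQ : linearly_general Q)
    (p : 'M[k]_(2, n)) (hp : gale_dual Q p)
    (y : 'M[k]_(2, n)) (hy : calG p y) :
  [/\ spec_closed_embedding (constxT n) (cox_subalg y p) (cox_map y p)
        (@spin_ideal k n),
      forall theta : fieldxT k n -> fieldzt k n,
        alg_iso (constxT n) (constzt n) (cox_subalg y p) (cox_ring Q) theta ->
        spec_closed_embedding (constzt n) (cox_ring Q)
          (fun g => theta (cox_map y p g)) (@spin_ideal k n) /\
        (forall g, kernel (fun g => theta (cox_map y p g)) g <->
                   kernel (cox_map y p) g),
      prime_ideal (kernel (cox_map y p)),
      homogeneous_ideal (kernel (cox_map y p))
    & forall g,
        ideal_sum (calG p)
          (fun c => scale_ideal (avec y p c) (@spin_ideal k n)) g ->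
        kernel (cox_map y p) g].
Proof.
have pp := gale_dual_plucker_neq0 hQ hp.
have epi := cox_map_epi p y; have spin0 := spin_ideal_cox_map p y.
split.
- exact: epi_closed_embedding.
- move=> theta iso; split; last exact: iso_kernel epi iso.
  apply: epi_closed_embedding; first exact: alg_epi_iso epi iso.
  by move=> g /spin0 g0; apply/(iso_kernel epi iso).
- exact: cox_kernel_prime.
- exact: cox_kernel_homogeneous.
- move=> g [s sP ->]; rewrite /kernel rmorph_sum big_seq big1 // => h /sP[c _].
  exact: scale_spin_ideal_cox_map.
Qed.
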